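(* Let $(G,v)$ and $(H,u)$ be rooted graphs with disjoint vertex sets, and let $(I,v)$ be their composition. Then (1) $B^1(I,v)=\min\{B^1(G,v),\,B^1(H,u),\,B^{11}(G,v)+B^0(H,u)\}$; (2) $B^{11}(I,v)=\min\{B^{11}(G,v),\,B^0(H,u)\}$; (3) $B^0(I,v)=\min\{B^0(G,v)+B^{11}(H,u),\,B^0(G,v)+B^0(H,u)\}$.
   Context: A rooted graph $(G,v)$ is a finite simple graph $G$ with a chosen vertex $v$. The composition of $(G,v)$ and $(H,u)$ is the rooted graph $(I,v)$ where $I$ is the disjoint union of $G$ and $H$ plus the new edge $vu$. For a set $W\subseteq V(G)$, vertices in $W$ are white and others black. A final zero blocking set of $G$ is a nonempty $W\subseteq V(G)$ such that no black vertex has exactly one white neighbor. A final $v$-zero blocking set of $(G,v)$ is a set $W\subseteq V(G)$ such that $v\notin W$, $v$ has at least one white neighbor, and every black vertex other than $v$ does not have exactly one white neighbor. Define (with $\min\emptyset=\infty$): $B^1(G,v)=\min\{|W|: v\notin W,\ W\text{ a final zero blocking set of }G\}$; $B^0(G,v)=\min\{|W|: v\in W,\ W\text{ a final zero blocking set of }G\}$; $B^{11}(G,v)=\min\{|W|: v\notin W,\ W\text{ a final } v\text{-zero blocking set of }G\}$. *)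

(* Defs.v *)
From mathcomp Require Import all_boot all_order all_algebra.
From mathcomp Require Import constructive_ereal.

Set Implicit Arguments.
Unset Strict Implicit.
Unset Printing Implicit Defensive.

Record sgraph := SGraph {
  vertex :> finType;
  adj : rel vertex;
  adj_sym : symmetric adj;
  adj_irr : irreflexive adj }.

Record rooted_graph := RootedGraph {
  graph :> sgraph;
  rvertex : graph }.

Section Composition.
Variables G H : rooted_graph.

(* The disjoint union of the vertex sets is the sum type [G + H]. *)
Definition comp_adj (x y : G + H) : bool :=
  match x, y with
  | inl a, inl b => adj a b
  | inr a, inr b => adj a b
  | inl a, inr b => (a == rvertex G) && (b == rvertex H)
  | inr a, inl b => (a == rvertex H) && (b == rvertex G)
  end.

Lemma comp_adj_sym : symmetric comp_adj.
Proof. by move=> [a|a] [b|b] //=; rewrite ?(adj_sym a b) // andbC. Qed.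

Lemma comp_adj_irr : irreflexive comp_adj.
Proof. by move=> [a|a] /=; apply: adj_irr. Qed.

Definition composition : rooted_graph :=
  @RootedGraph (SGraph comp_adj_sym comp_adj_irr) (inl (rvertex G)).

End Composition.

Definition white_neighbors (G : sgraph) (W : {set G}) (x : G) : {set G} :=
  [set y in W | adj x y].

Definition final_zbs (G : sgraph) (W : {set G}) : bool :=
  (W != set0) &&
  [forall x : G, (x \notin W) ==> (#|white_neighbors W x| != 1)].

Definition final_root_zbs (G : rooted_graph) (W : {set G}) : bool :=
  [&& rvertex G \notin W,
      0 < #|white_neighbors W (rvertex G)| &
      [forall x : G, (x \notin W) && (x != rvertex G) ==>
                       (#|white_neighbors W x| != 1)]].

(* [\bar int] is used so that the minimum over the empty family is [+oo]. *)
Definition min_card (T : finType) (P : pred {set T}) : \bar int :=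
  \big[Order.min/+oo%E]_(W : {set T} | P W) (Posz #|W|)%:E.

Definition B1 (G : rooted_graph) : \bar int :=
  min_card [pred W : {set G} | (rvertex G \notin W) && final_zbs W].

Definition B0 (G : rooted_graph) : \bar int :=
  min_card [pred W : {set G} | (rvertex G \in W) && final_zbs W].

Definition B11 (G : rooted_graph) : \bar int :=
  min_card [pred W : {set G} | (rvertex G \notin W) && final_root_zbs W].

(* Main.v *)
Require Import Defs.
From mathcomp Require Import all_boot all_order all_algebra.
From mathcomp Require Import constructive_ereal.

(** A white set of the composition is a pair [(A, B)] of white sets of [G] and
    [H]. The new edge only affects the white neighbour counts of the two roots:
    that of [v] grows by one if [u \in B], that of [u] by one if [v \in A].
    Hence the blocking conditions away from the roots decouple, and every claim
    reduces to a case analysis on the colours of the two roots. *)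

Set Implicit Arguments.
Unset Strict Implicit.
Unset Printing Implicit Defensive.

Import Order.TTheory.

(** * Bounds for minimal cardinalities with values in [\bar int] *)

Section MinCard.
Local Open Scope ereal_scope.
Implicit Types (S T : finType) (x : \bar int).

Lemma eq_min_card T (P Q : pred {set T}) : P =1 Q -> min_card P = min_card Q.
Proof. exact: eq_bigl. Qed.

Lemma min_card_le T (P : pred {set T}) (W : {set T}) :
  P W -> min_card P <= (Posz #|W|)%:E.
Proof. by move=> PW; rewrite /min_card (bigD1 W) //= ge_min lexx. Qed.

Lemma le_min_card T (P : pred {set T}) x :
  (forall W, P W -> x <= (Posz #|W|)%:E) -> x <= min_card P.
Proof.
move=> le_x; rewrite /min_card; elim/big_ind: _ => [|y z|W /le_x //].
  exact: leey.
by rewrite le_min => -> ->.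
Qed.

(** The minimum of two values is one of them, so folding over a finite family yields either a
    member's value or the default [+oo]. *)
Lemma min_card_attained T (P : pred {set T}) :
  min_card P = +oo \/ exists2 W, P W & min_card P = (Posz #|W|)%:E.
Proof.
rewrite /min_card; elim/big_ind: _ => [|y z Hy Hz|W PW]; first by left.
  by rewrite minEle; case: ifP.
by right; exists W.
Qed.

(** If either family is empty, the sum is [+oo] and the bound is trivial; otherwise both minima are
    attained and the hypothesis applies to the two minimisers. *)
Lemma le_min_cardD S T (P : pred {set S}) (Q : pred {set T}) x :
  (forall A B, P A -> Q B -> x <= (Posz (#|A| + #|B|))%:E) ->
  x <= min_card P + min_card Q.
Proof.
move=> le_x.
case: (min_card_attained P) => [->|[A PA ->]];
case: (min_card_attained Q) => [->|[B QB ->]]; rewrite ?leey //.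
by rewrite -EFinD -PoszD le_x.
Qed.

Lemma min_cardD_le S T (P : pred {set S}) (Q : pred {set T}) A B :
  P A -> Q B -> min_card P + min_card Q <= (Posz (#|A| + #|B|))%:E.
Proof.
by move=> PA QB; rewrite PoszD EFinD leeD // min_card_le.
Qed.

End MinCard.

(** * Separating the condition at the root from the conditions elsewhere *)

Definition root_count (G : rooted_graph) (W : {set G}) : nat :=
  #|white_neighbors W (rvertex G)|.

(** The requirement shared by all three minima, which then differ only in what they ask at the root
    and in nonemptiness. *)
Definition off_root (G : rooted_graph) (W : {set G}) : bool :=
  [forall x : G, (x \notin W) && (x != rvertex G) ==>
                   (#|white_neighbors W x| != 1)].

Lemma final_zbsE (G : rooted_graph) (W : {set G}) :
  final_zbs W = [&& W != set0, off_root W &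
                    (rvertex G \in W) || (root_count W != 1)].
Proof.
rewrite /final_zbs; congr (_ && _).
apply/forallP/andP => [W_ok|[/forallP W_off W_root] x].
  split; last by have := W_ok (rvertex G); rewrite implyNb.
  by apply/forallP=> x; apply/implyP=> /andP[xW _]; apply: (implyP (W_ok x)).
apply/implyP=> xW; have [eq_x|ne_x] := eqVneq x (rvertex G).
  by move: W_root xW; rewrite eq_x => /orP[-> //|].
by apply: (implyP (W_off x)); rewrite xW.
Qed.

Lemma B1E (G : rooted_graph) :
  B1 G = min_card [pred W : {set G} |
    [&& rvertex G \notin W, W != set0, off_root W & root_count W != 1]].
Proof.
by apply: eq_min_card => W /=; rewrite final_zbsE; case: (_ \in W).
Qed.

(** A white root makes the set nonempty and the condition at the root vacuous. *)
Lemma B0E (G : rooted_graph) :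
  B0 G = min_card [pred W : {set G} | (rvertex G \in W) && off_root W].
Proof.
apply: eq_min_card => W /=; rewrite final_zbsE.
case: (boolP (_ \in W)) => //= vW; rewrite andbT.
by have -> : W != set0 by apply/set0Pn; exists (rvertex G).
Qed.

Lemma B11E (G : rooted_graph) :
  B11 G = min_card [pred W : {set G} |
    [&& rvertex G \notin W, 0 < root_count W & off_root W]].
Proof. by apply: eq_min_card => W /=; rewrite /final_root_zbs andbA andbb. Qed.

(** Serves, with [off_root0], to extend a white set of one factor by the empty set on the other. *)
Lemma root_count0 (G : rooted_graph) : root_count (set0 : {set G}) = 0.
Proof.
by apply/eqP; rewrite cards_eq0; apply/eqP/setP=> x; rewrite !inE.
Qed.

Lemma off_root0 (G : rooted_graph) : off_root (set0 : {set G}).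
Proof.
apply/forallP=> x; apply/implyP=> _.
suff -> : white_neighbors set0 x = set0 by rewrite cards0.
by apply/setP=> y; rewrite !inE.
Qed.

(** * Subsets of a disjoint union as pairs of subsets *)

Section SumSet.
Variables S T : finType.

Definition sum_set (A : {set S}) (B : {set T}) : {set S + T} :=
  [set x | match x with inl a => a \in A | inr b => b \in B end].

Lemma sum_set_surj (W : {set S + T}) :
  W = sum_set (inl @^-1: W) (inr @^-1: W).
Proof. by apply/setP=> -[a|b]; rewrite !inE. Qed.

Lemma card_sum_set (A : {set S}) (B : {set T}) :
  #|sum_set A B| = #|A| + #|B|.
Proof.
rewrite -!sum1_card big_sumType /=.
by congr (_ + _); apply: eq_bigl => x; rewrite inE.
Qed.

Lemma sum_set_eq0 (A : {set S}) (B : {set T}) :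
  (sum_set A B == set0) = (A == set0) && (B == set0).
Proof. by rewrite -!cards_eq0 card_sum_set addn_eq0. Qed.

End SumSet.

(** * White sets of the composition and the three formulas *)

Section CompositionSets.
Variables G H : rooted_graph.
Implicit Types (A : {set G}) (B : {set H}).

(** The type is fixed to the vertices of the composition, so that the graph notions apply. *)
Definition comp_set A B : {set composition G H} := sum_set A B.

Lemma comp_set_surj (W : {set composition G H}) :
  exists A B, W = comp_set A B.
Proof. by do 2!eexists; apply: sum_set_surj. Qed.

Lemma card_comp_set A B : #|comp_set A B| = #|A| + #|B|.
Proof. exact: card_sum_set. Qed.

Lemma card_comp_setl A : #|comp_set A set0| = #|A|.
Proof. by rewrite card_comp_set cards0 addn0. Qed.

Lemma card_comp_setr B : #|comp_set set0 B| = #|B|.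
Proof. by rewrite card_comp_set cards0. Qed.

Lemma comp_set_eq0 A B : (comp_set A B == set0) = (A == set0) && (B == set0).
Proof. exact: sum_set_eq0. Qed.

Lemma root_comp_set A B :
  (rvertex (composition G H) \in comp_set A B) = (rvertex G \in A).
Proof. by rewrite inE. Qed.

(** Expresses the contribution of the new edge, 0 or 1, as the cardinality of a set, so that
    [card_sum_set] can absorb it. *)
Lemma card_guarded_set1 (T : finType) (b : bool) (x : T) :
  #|[set y | b && (y == x)]| = b.
Proof.
case: b => /=; first by rewrite -(cards1 x); apply: eq_card => y; rewrite !inE.
by rewrite -(cards0 T); apply: eq_card => y; rewrite !inE.
Qed.

Lemma white_neighbors_inl A B (a : G) :
  #|white_neighbors (comp_set A B) (inl a : composition G H)| =
  #|white_neighbors A a| + ((a == rvertex G) && (rvertex H \in B)).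
Proof.
rewrite -(card_guarded_set1 _ (rvertex H)) -card_sum_set; apply: eq_card.
case=> [x|y]; rewrite !inE //=.
by have [->|_] := eqVneq y (rvertex H); rewrite ?andbF // !andbT andbC.
Qed.

Lemma white_neighbors_inr A B (b : H) :
  #|white_neighbors (comp_set A B) (inr b : composition G H)| =
  #|white_neighbors B b| + ((b == rvertex H) && (rvertex G \in A)).
Proof.
rewrite -(card_guarded_set1 _ (rvertex G)) addnC -card_sum_set; apply: eq_card.
case=> [x|y]; rewrite !inE //=.
by have [->|_] := eqVneq x (rvertex G); rewrite ?andbF // !andbT andbC.
Qed.

Lemma root_count_comp_set A B :
  root_count (comp_set A B) = root_count A + (rvertex H \in B).
Proof. by rewrite /root_count white_neighbors_inl eqxx. Qed.

(** The root of the composition is [inl (rvertex G)], so the root of [H] becomes an ordinary vertex: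
    its condition, with the new edge counted, is the third conjunct. *)
Lemma off_root_comp_set A B :
  off_root (comp_set A B) =
  [&& off_root A, off_root B &
      (rvertex H \in B) || (root_count B + (rvertex G \in A) != 1)].
Proof.
apply/forallP/and3P => [ok|[/forallP okA /forallP okB okH] [a|b]].
- split.
  + apply/forallP=> a; apply/implyP=> /andP[aA ne_a].
    have := ok (inl a); rewrite white_neighbors_inl inE aA (negPf ne_a) addn0.
    by move/implyP; apply.
  + apply/forallP=> b; apply/implyP=> /andP[bB ne_b].
    have := ok (inr b).
    by rewrite white_neighbors_inr !inE bB (negPf ne_b) addn0.
  + have := ok (inr (rvertex H)).
    by rewrite white_neighbors_inr !inE eqxx /= andbT implyNb.
- apply/implyP=> /andP[]; rewrite inE white_neighbors_inl => aA ne_a.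
  (* The inequality between [inl] terms reduces to this one by computation. *)
  have {}ne_a : a != rvertex G by [].
  by rewrite (negPf ne_a) addn0; apply: (implyP (okA a)); rewrite aA.
- apply/implyP=> /andP[]; rewrite inE white_neighbors_inr => bB _.
  have [eq_b|ne_b] := eqVneq b (rvertex H).
    by move: okH bB; rewrite eq_b => /orP[-> //|].
  by rewrite addn0; apply: (implyP (okB b)); rewrite bB.
Qed.

Definition comp_setE := (card_comp_set, comp_set_eq0, root_comp_set,
  root_count_comp_set, off_root_comp_set).

Lemma le_comp_cardl A B : ((Posz #|A|)%:E <= (Posz #|comp_set A B|)%:E)%E.
Proof. by rewrite lee_fin lez_nat card_comp_set leq_addr. Qed.

Lemma le_comp_cardr A B : ((Posz #|B|)%:E <= (Posz #|comp_set A B|)%:E)%E.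
Proof. by rewrite lee_fin lez_nat card_comp_set leq_addl. Qed.

(** For the upper bound, each candidate on the right yields a white set: [A] alone, [B] alone, or
    both. For the lower bound, the colour of [u] decides which candidate applies. *)
Lemma B1_composition :
  B1 (composition G H) =
    Order.min (Order.min (B1 G) (B1 H)) (B11 G + B0 H)%E.
Proof.
rewrite !B1E B11E B0E; apply/le_anti/andP; split.
- rewrite !le_min -!andbA; apply/and3P; split.
  + apply: le_min_card => A /= /and4P[vA A0 offA cA].
    rewrite -card_comp_setl; apply: min_card_le.
    rewrite /= !comp_setE !inE root_count0 off_root0 offA.
    by rewrite (negPf vA) (negPf A0) !addn0 cA.
  + apply: le_min_card => B /= /and4P[uB B0 offB cB].
    rewrite -card_comp_setr; apply: min_card_le.
    rewrite /= !comp_setE !inE root_count0 off_root0 offB.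
    by rewrite (negPf uB) (negPf B0) !addn0 cB andbF.
  + apply: le_min_cardD => A B /= /and3P[vA cA offA] /andP[uB offB].
    rewrite -card_comp_set; apply: min_card_le.
    rewrite /= !comp_setE offA offB uB (negPf vA) /=.
    have -> : (B == set0) = false by apply/set0Pn; exists (rvertex H).
    (* The root [v] sees [u] besides at least one white vertex of [A], hence at least two. *)
    by rewrite andbF addn1 eqSS -lt0n.
- apply: le_min_card => W; have [A [B ->]] := comp_set_surj W.
  rewrite /= !comp_setE => /and4P[vA AB0 /and3P[offA offB uB] cA].
  rewrite !ge_min; move: uB cA; case: (boolP (_ \in B)) => /= uB.
    (* With [u] white, a count at [v] other than 1 forces a white neighbour of [v] inside [G]. *)
    rewrite addn1 eqSS -lt0n => _ cA; apply/orP; right.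
    by apply: min_cardD_le => /=; rewrite ?vA ?cA ?uB.
  (* With both roots black the new edge carries nothing, so whichever of [A] and [B] is nonempty is
     blocking in its own factor. *)
  rewrite (negPf vA) !addn0 => cB cA; rewrite -card_comp_set; apply/orP; left.
  move: AB0; rewrite negb_and => /orP[A0|B0]; apply/orP; [left|right].
    apply: le_trans (le_comp_cardl A B).
    by apply: min_card_le; rewrite /= vA A0 offA.
  apply: le_trans (le_comp_cardr A B).
  by apply: min_card_le; rewrite /= uB B0 offB.
Qed.

Lemma B11_composition : B11 (composition G H) = Order.min (B11 G) (B0 H).
Proof.
rewrite !B11E B0E; apply/le_anti/andP; split.
- rewrite le_min; apply/andP; split.
  + apply: le_min_card => A /= /and3P[vA cA offA].
    rewrite -card_comp_setl; apply: min_card_le.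
    rewrite /= !comp_setE !inE root_count0 off_root0 offA.
    by rewrite (negPf vA) !addn0 cA.
  + apply: le_min_card => B /= /andP[uB offB].
    rewrite -card_comp_setr; apply: min_card_le.
    (* The white vertex [u] is by itself the white neighbour that [v] needs. *)
    by rewrite /= !comp_setE !inE root_count0 off_root0 offB uB.
- apply: le_min_card => W; have [A [B ->]] := comp_set_surj W.
  rewrite [X in X -> _]/= root_comp_set root_count_comp_set off_root_comp_set.
  move=> /and3P[vA cA /and3P[offA offB _]]; rewrite ge_min; apply/orP.
  (* The white neighbour of [v] is either [u], making [B] a candidate for [B0 H], or lies in [A]. *)
  move: cA; case: (boolP (_ \in B)) => uB.
    right; apply: le_trans (le_comp_cardr A B).
    by apply: min_card_le; rewrite /= uB.
  rewrite addn0 => cA; left; apply: le_trans (le_comp_cardl A B).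
  by apply: min_card_le; rewrite /= vA cA.
Qed.

Lemma B0_composition :
  B0 (composition G H) = Order.min (B0 G + B11 H)%E (B0 G + B0 H)%E.
Proof.
rewrite !B0E B11E; apply/le_anti/andP; split.
- rewrite le_min; apply/andP; split.
  + apply: le_min_cardD => A B /= /andP[vA offA] /and3P[uB cB offB].
    rewrite -card_comp_set; apply: min_card_le.
    by rewrite /= !comp_setE vA offA offB addn1 eqSS -lt0n cB orbT.
  + apply: le_min_cardD => A B /= /andP[vA offA] /andP[uB offB].
    rewrite -card_comp_set; apply: min_card_le.
    by rewrite /= !comp_setE vA offA offB uB.
- apply: le_min_card => W; have [A [B ->]] := comp_set_surj W.
  rewrite /= !comp_setE => /andP[vA /and3P[offA offB]].
  (* Since [v] is white, a black [u] must have another white neighbour inside [H], which is the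
     extra requirement in [B11 H]. *)
  rewrite vA addn1 eqSS -lt0n ge_min; case: (boolP (_ \in B)) => /= uB cB.
    by apply/orP; right; apply: min_cardD_le; rewrite /= ?vA ?uB.
  by apply/orP; left; apply: min_cardD_le; rewrite /= ?vA ?uB ?cB.
Qed.

End CompositionSets.

Theorem theorem9 (G H : rooted_graph) :
  [/\ B1 (composition G H) =
        Order.min (Order.min (B1 G) (B1 H)) (B11 G + B0 H)%E,
      B11 (composition G H) = Order.min (B11 G) (B0 H) &
      B0 (composition G H) = Order.min (B0 G + B11 H)%E (B0 G + B0 H)%E].
Proof.
by split; [exact: B1_composition|exact: B11_composition|exact: B0_composition].
Qed.
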